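(* Consider the MPS model and its neural tangent kernel $K_D$ described in the context. For any two inputs $\mathbf{x}^{(i)},\mathbf{x}^{(j)}\in\mathbb{R}^n$, as the bond dimensions $D_1,\dots,D_n\to\infty$ sequentially, $$K_D(\mathbf{x}^{(i)},\mathbf{x}^{(j)})\xrightarrow{\text{Prob.}}\sum_{k=1}^n\phi_k(x^{(i)}_k)\cdot\phi_k(x^{(j)}_k)\prod_{l=1,\,l\neq k}^{n}\sigma_l^2\,\phi_l(x^{(i)}_l)\cdot\phi_l(x^{(j)}_l),$$ a deterministic (static) limit.
   Context: Fix $n\ge 1$, finite physical dimensions $d_1,\dots,d_n$, feature maps $\phi_i:\mathbb{R}\to\mathbb{R}^{d_i}$ with components $\phi_i^{s}$, and constants $\sigma_1,\dots,\sigma_n>0$; $\cdot$ is the Euclidean inner product. For bond dimensions $D_1,\dots,D_n$ put $D_{n+1}=D_1$. The MPS parameters are tensors $A^{(i)}_{s;a,b}$, $s\le d_i$, $a\le D_i$, $b\le D_{i+1}$, initialized with all entries independent, $A^{(i)}_{s;a,b}\sim\mathcal{N}(0,\sigma_i^2/\sqrt{D_iD_{i+1}})$. The MPS output is $\Psi(\mathbf{x})=\sum_{s_1,\dots,s_n}\sum_{a_1,\dots,a_n}A^{(1)}_{s_1;a_1a_2}\cdots A^{(n)}_{s_n;a_na_1}\prod_{i=1}^n\phi_i^{s_i}(x_i)$ for $\mathbf{x}=(x_1,\dots,x_n)$. With learning rates $\eta_k=(D_kD_{k+1})^{-1/2}$, the neural tangent kernel (NTK) of the MPS is $$K_D(\mathbf{x},\mathbf{x}')=\sum_{k=1}^n\eta_k\sum_{s\le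 d_k}\sum_{a\le D_k}\sum_{b\le D_{k+1}}\frac{\partial\Psi(\mathbf{x})}{\partial A^{(k)}_{s;a,b}}\,\frac{\partial\Psi(\mathbf{x}')}{\partial A^{(k)}_{s;a,b}},$$ evaluated at the random initialization. ''Sequentially'' means iterated limits, the bond dimensions being sent to infinity one after another. *)

(* Defs.v *)
From HB Require Import structures.
From mathcomp Require Import all_boot all_order all_algebra.
From mathcomp Require Import all_classical all_reals all_analysis.
Set Implicit Arguments. Unset Strict Implicit. Unset Printing Implicit Defensive.
Import Order.TTheory GRing.Theory Num.Theory.
Local Open Scope classical_set_scope.
Local Open Scope ring_scope.

Section MPS.
Variable R : realType.
Variable n : nat.
(* physical dimensions d_k and bond dimensions D_k, sites indexed by 'I_n
   (0-based); the cyclic successor ordS k plays the role of k+1, so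
   D (ordS (n-1)) = D 0, i.e. D_{n+1} = D_1. *)
Variable d : 'I_n -> nat.

Definition mps_idx (D : 'I_n -> nat) : finType :=
  {k : 'I_n & ('I_(d k) * 'I_(D k) * 'I_(D (ordS k)))%type}.

Definition entry (D : 'I_n -> nat) (k : 'I_n) (s : 'I_(d k)) (a : 'I_(D k))
  (b : 'I_(D (ordS k))) : mps_idx D := Tagged _ (s, a, b).

Definition mps_out (D : 'I_n -> nat) (phi : forall k : 'I_n, R -> 'I_(d k) -> R)
  (A : mps_idx D -> R) (x : 'I_n -> R) : R :=
  \sum_(s : {dffun forall k : 'I_n, 'I_(d k)})
  \sum_(a : {dffun forall k : 'I_n, 'I_(D k)})
    (\prod_(k : 'I_n) A (entry (s k) (a k) (a (ordS k)))) *
    \prod_(k : 'I_n) phi k (x k) (s k).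

Definition upd (D : 'I_n -> nat) (A : mps_idx D -> R) (i : mps_idx D) (t : R)
  : mps_idx D -> R := fun j => if j == i then t else A j.

Definition dmps (D : 'I_n -> nat) (phi : forall k : 'I_n, R -> 'I_(d k) -> R)
  (A : mps_idx D -> R) (x : 'I_n -> R) (i : mps_idx D) : R :=
  derive1 (fun t : R => mps_out phi (upd A i t) x) (A i).

Definition eta (D : 'I_n -> nat) (k : 'I_n) : R :=
  (Num.sqrt (((D k) * (D (ordS k)))%N%:R))^-1.

Definition ntk (D : 'I_n -> nat) (phi : forall k : 'I_n, R -> 'I_(d k) -> R)
  (A : mps_idx D -> R) (x x' : 'I_n -> R) : R :=
  \sum_(i : mps_idx D) eta D (tag i) * dmps phi A x i * dmps phi A x' i.

Definition fdot (phi : forall k : 'I_n, R -> 'I_(d k) -> R) (k : 'I_n) (y y' : R) : R :=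
  \sum_(s : 'I_(d k)) phi k y s * phi k y' s.

Definition ntk_limit (phi : forall k : 'I_n, R -> 'I_(d k) -> R) (sigma : 'I_n -> R)
  (x x' : 'I_n -> R) : R :=
  \sum_(k : 'I_n) fdot phi k (x k) (x' k) *
     \prod_(l : 'I_n | l != k) (sigma l ^+ 2 * fdot phi l (x l) (x' l)).

End MPS.

Definition setdim (n : nat) (D : 'I_n -> nat) (l : 'I_n) (N : nat) : 'I_n -> nat :=
  fun j => if j == l then N else D j.

(* Sequential (iterated) upper limit: for the order s = [:: l1; l2; ...],
   first D_{l1} -> oo, then D_{l2} -> oo, ... (limsup at each stage). *)
Fixpoint seq_limsup {R : realType} (n : nat) (s : seq 'I_n)
  (f : ('I_n -> nat) -> R) : ('I_n -> nat) -> R :=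
  match s with
  | [::] => f
  | l :: s' => seq_limsup s' (fun D => limn_sup (fun N : nat => f (setdim D l N)))
  end.

Definition mutually_independent {R : realType} d (T : measurableType d)
  (P : probability T R) (I : finType) (X : I -> T -> R) : Prop :=
  forall B : I -> set R, (forall i, measurable (B i)) ->
    P (\bigcap_(i in [set: I]) (X i @^-1` B i)) =
    (\prod_(i : I) P (X i @^-1` B i))%E.

Definition centered_gaussian {R : realType} d (T : measurableType d)
  (P : probability T R) (X : T -> R) (v : R) : Prop :=
  measurable_fun [set: T] X /\
  forall B : set R, measurable B -> P (X @^-1` B) = normal_prob 0 (Num.sqrt v) B.

(* Main.v *)
Require Import Defs.
From HB Require Import structures.
From mathcomp Require Import all_boot all_order all_algebra.
From mathcomp Require Import all_classical all_reals all_analysis.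
From mathcomp Require Import perm measurable_realfun ring lra.
Import Order.TTheory GRing.Theory Num.Theory numFieldNormedType.Exports.
Local Open Scope classical_set_scope.
Local Open Scope ring_scope.
Set Implicit Arguments.
Unset Strict Implicit.
Unset Printing Implicit Defensive.

(** Write [K = \sum_k eta_k Y_k], where [Y_k] is a sum over two copies of the
    physical and bond indices that are glued together at site [k].  Independence
    and Wick's formula give the mean of [eta_k Y_k] exactly: every site of the
    two copies must match, the bond sums give [\prod_l D_l], and the variances
    times the learning rate give [\prod_l D_l^-1].  For the second moment four
    copies occur, and Wick's formula turns it into a sum over assignments [p] of
    one of the three pairings of the copies to each site, site [k] carrying the
    pairing 12|34.  Each bond contributes [1] if its two sites carry the same
    pairing and [1 / D_l] otherwise, so the constant assignment gives the
    square of the mean and every other one is at most a constant times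
    [\sum_l 1 / D_l].  Chebyshev's inequality then bounds the deviation
    probability by [C \sum_l 1 / D_l], and the successive upper limits remove
    the terms of this sum one at a time, in whatever order. *)

(** * Reduction of weighted integrals of nonnegative functions to indicators *)

Section WeightedIntegral.
Context {R : realType}.
Local Open Scope ereal_scope.
Import HBNNSimple.

Section OneSide.
Context d d' (T : measurableType d) (S : measurableType d').
Variables (mu : {measure set T -> \bar R}) (p : T -> R) (X : T -> S).
Hypotheses (p0 : forall x, (0 <= p x)%R) (mp : measurable_fun setT p).
Hypothesis mX : measurable_fun setT X.

Let mXB (B : set S) : measurable B -> measurable_fun setT (\1_B \o X : T -> R).
Proof. by move=> mB; apply: measurableT_comp. Qed.

(** A simple function is a finite combination of indicators of its level sets, so its weighted
    integral only involves weighted integrals of indicators. *)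
Lemma weighted_integral_nnsfun (h : {nnsfun S >-> R}) :
  \int[mu]_x (p x * h (X x))%:E =
  \sum_(y \in range h) y%:E * \int[mu]_x (p x * \1_(h @^-1` [set y]) (X x))%:E.
Proof.
under eq_integral => x _ do rewrite fimfunE mulr_fsumr// -fsumEFin//.
have my y : measurable (h @^-1` [set y]) by exact: measurable_funPTI.
have mt y : measurable_fun setT (fun x => p x * \1_(h @^-1` [set y]) (X x))%R.
  by apply: measurable_funM => //; exact: mXB.
have yh y : y \notin Num.nneg -> h @^-1` [set y] = set0.
  move=> y0; rewrite preimage_nnfun0// ltNge; exact: y0.
have E y x : (p x * (y * \1_(h @^-1` [set y]) (X x)))%:E =
    y%:E * (p x * \1_(h @^-1` [set y]) (X x))%:E.
  by rewrite -EFinM mulrCA.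
rewrite ge0_integral_fsum//; last 2 first.
  move=> y; under eq_fun do rewrite E.
  by apply: measurable_funeM; exact/measurable_EFinP.
- move=> y x _; rewrite lee_fin mulr_ge0//.
  have [y0|y0] := boolP (y \in Num.nneg); first by rewrite mulr_ge0.
  by rewrite yh// indic0 mulr0.
apply: eq_fsbigr => y /[!inE] -[s _ <-].
under eq_integral do rewrite E.
rewrite ge0_integralZl//; first exact/measurable_EFinP.
- by move=> x _; rewrite lee_fin mulr_ge0.
- by rewrite lee_fin.
Qed.

(** Monotone convergence along the canonical increasing simple approximations of [g]; the
    nonnegative weight preserves monotonicity. *)
Lemma weighted_integral_approx (g : S -> R) (mg : measurable_fun setT (EFin \o g)) :
  (forall y, (0 <= g y)%R) ->
  \int[mu]_x (p x * nnsfun_approx measurableT mg n (X x))%:E @[n --> \oo] -->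
  \int[mu]_x (p x * g (X x))%:E.
Proof.
move=> g0; set a := nnsfun_approx _ _.
have -> : \int[mu]_x (p x * g (X x))%:E =
    \int[mu]_x (limn (fun n => (p x * a n (X x))%:E)).
  apply: eq_integral => x _; apply/esym/cvg_lim => //.
  rewrite EFinM; under eq_fun do rewrite EFinM.
  apply: cvgeZl => //.
  apply: (@cvg_nnsfun_approx _ _ _ setT measurableT (EFin \o g) mg) => //.
  by move=> y _; rewrite lee_fin.
apply: cvg_monotone_convergence => //.
- move=> n; apply/measurable_EFinP/measurable_funM => //.
  exact: measurableT_comp.
- by move=> n x _; rewrite lee_fin mulr_ge0.
- move=> x _ m n mn; rewrite lee_fin ler_wpM2l//.
  exact/lefP/nd_nnsfun_approx.
Qed.

End OneSide.

(* Covers both densities ([X2] the identity) and independence ([p1] the product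
   of the other factors, [p2] a constant). *)
Lemma eq_weighted_integral d1 d2 d (T1 : measurableType d1)
    (T2 : measurableType d2) (S : measurableType d)
    (mu1 : {measure set T1 -> \bar R}) (mu2 : {measure set T2 -> \bar R})
    (p1 : T1 -> R) (p2 : T2 -> R) (X1 : T1 -> S) (X2 : T2 -> S) :
  (forall x, (0 <= p1 x)%R) -> measurable_fun setT p1 -> measurable_fun setT X1 ->
  (forall x, (0 <= p2 x)%R) -> measurable_fun setT p2 -> measurable_fun setT X2 ->
  (forall B, measurable B -> \int[mu1]_x (p1 x * \1_B (X1 x))%:E =
                             \int[mu2]_x (p2 x * \1_B (X2 x))%:E) ->
  forall g : S -> R, measurable_fun setT g -> (forall y, (0 <= g y)%R) ->
  \int[mu1]_x (p1 x * g (X1 x))%:E = \int[mu2]_x (p2 x * g (X2 x))%:E.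
Proof.
move=> p10 mp1 mX1 p20 mp2 mX2 eqB g mg g0.
have meg : measurable_fun setT (EFin \o g) by exact/measurable_EFinP.
have /cvg_lim <- // := @weighted_integral_approx _ _ _ _ mu1 p1 X1 p10 mp1 mX1 g meg g0.
have /cvg_lim <- // := @weighted_integral_approx _ _ _ _ mu2 p2 X2 p20 mp2 mX2 g meg g0.
congr (limn _); apply/funext => n.
rewrite !weighted_integral_nnsfun//.
by apply: eq_fsbigr => y _; rewrite eqB//; exact: measurable_funPTI.
Qed.

End WeightedIntegral.

(** * Expectations, and products of independent variables *)

Section Expectation.
Context {R : realType} {dT : measure_display} {T : measurableType dT}.
Variable P : probability T R.
Implicit Types (f g : T -> R) (u v c : R).

(** Integrability and value are bundled so that linearity passes through finite sums with no side
    condition. *)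
Definition has_expectation (f : T -> R) (v : R) : Prop :=
  P.-integrable setT (EFin \o f) /\ (\int[P]_w (f w)%:E = v%:E)%E.

Lemma has_expectation_eq f g u v :
  f =1 g -> u = v -> has_expectation f u -> has_expectation g v.
Proof. by move=> /funext -> ->. Qed.

Lemma has_expectation_ge0 f v : (forall w, 0 <= f w) -> measurable_fun setT f ->
  (\int[P]_w (f w)%:E = v%:E)%E -> has_expectation f v.
Proof.
move=> f0 mf fv; split => //; apply/integrableP; split.
  exact/measurable_EFinP.
under eq_integral do rewrite /= ger0_norm//.
by rewrite fv ltry.
Qed.

Lemma has_expectation_cst (c : R) : has_expectation (fun _ => c) c.
Proof.
split; first exact: finite_measure_integrable_cst.
by rewrite integral_cst//= probability_setT mule1.
Qed.

Lemma has_expectationZ c f v :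
  has_expectation f v -> has_expectation (fun w => c * f w) (c * v).
Proof.
move=> [fi fv]; split; first exact: (integrableZl _ c fi).
under eq_integral do rewrite EFinM.
by rewrite integralZl// fv.
Qed.

Lemma has_expectationD f g u v : has_expectation f u -> has_expectation g v ->
  has_expectation (fun w => f w + g w) (u + v).
Proof.
move=> [fi fv] [gi gv]; split; first exact: (integrableD _ fi gi).
under eq_integral do rewrite EFinD.
by rewrite integralD// fv gv.
Qed.

Lemma has_expectation_sum (I : Type) (s : seq I) (Q : pred I) (f : I -> T -> R) (v : I -> R) :
  (forall i, Q i -> has_expectation (f i) (v i)) ->
  has_expectation (fun w => \sum_(i <- s | Q i) f i w) (\sum_(i <- s | Q i) v i).
Proof.
move=> fv; elim: s => [|i s ih].
  rewrite big_nil; apply: has_expectation_eq (has_expectation_cst 0) => // w.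
  by rewrite big_nil.
rewrite big_cons; case: ifPn => Qi; last first.
  by apply: has_expectation_eq ih => // w; rewrite big_cons (negbTE Qi).
apply: has_expectation_eq (has_expectationD (fv i Qi) ih) => // w.
by rewrite big_cons Qi.
Qed.

Lemma has_expectation_le f g u v : has_expectation f u -> has_expectation g v ->
  (forall w, f w <= g w) -> u <= v.
Proof.
move=> [fi fu] [gi gv] fg; rewrite -lee_fin -fu -gv.
by apply: le_integral => // w _; rewrite lee_fin.
Qed.

Lemma has_expectation_indic (A : set T) : measurable A ->
  has_expectation \1_A (fine (P A)).
Proof.
move=> mA; apply: has_expectation_ge0 => //.
by rewrite integral_indic// setIT fineK// fin_num_measure.
Qed.

Section Independence.
Variables (I : finType) (X : I -> T -> R).
Hypotheses (mX : forall i, measurable_fun setT (X i))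
  (indep : mutually_independent P X).

Let preim_measurable i (B : set R) : measurable B -> measurable (X i @^-1` B).
Proof. by move=> mB; rewrite -[X in measurable X]setTI; exact: mX. Qed.

Let measurable_prodX (g : I -> R -> R) (Q : pred I) :
  (forall i, measurable_fun setT (g i)) ->
  measurable_fun setT (fun w => \prod_(i | Q i) g i (X i w)).
Proof.
move=> mg; under eq_fun do rewrite -big_filter.
by apply: measurable_prod => i _; exact: measurableT_comp.
Qed.

(** The list [s] holds the indices whose function may still be arbitrary; all others carry
    indicators. With [s] empty the claim is the definition of independence, and each induction step
    frees one index from being an indicator. *)
Let expectation_prod_rec (s : seq I) (g : I -> R -> R) (m : I -> R) :
  uniq s ->
  (forall i, measurable_fun setT (g i)) -> (forall i y, 0 <= g i y) ->
  (forall i, has_expectation (fun w => g i (X i w)) (m i)) ->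
  (forall i, i \notin s -> exists2 B, measurable B & g i = \1_B) ->
  has_expectation (fun w => \prod_i g i (X i w)) (\prod_i m i).
Proof.
elim: s g m => [|i s ih] g m.
  move=> _ mg g0 gm /(_ _ isT) gB.
  have /choice[B BP] : forall i, exists B, measurable B /\ g i = \1_B.
    by move=> i; have [B mB ->] := gB i; exists B.
  have mB i : measurable (B i) by have [] := BP i.
  have gE i : g i = \1_(B i) by have [] := BP i.
  have mcap : measurable (\bigcap_(i in [set: I]) (X i @^-1` B i)).
    apply: fin_bigcap_measurable => [|i _]; last exact: preim_measurable.
    exact: finite_finset.
  apply: has_expectation_eq (has_expectation_indic mcap).
    move=> w; under eq_bigr do rewrite gE indicE.
    rewrite indicE; have [wB|wB] := boolP (w \in _).
      rewrite big1// => i _; rewrite mem_set//.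
      by move: wB; rewrite inE; exact.
    move: wB; rewrite notin_setE => /existsNP[i /not_implyP[_ wi]].
    by rewrite (bigD1 i)//= memNset ?mul0r.
  rewrite indep// (eq_bigr (fun i => (m i)%:E)).
    by rewrite prodEFin.
  move=> i _; have [_ <-] := gm i.
  rewrite gE -[RHS]/(\int[P]_w (\1_(X i @^-1` B i) w)%:E)%E.
  by rewrite integral_indic ?setIT//; exact: preim_measurable.
move=> /= /andP[iNs us] mg g0 gm gB.
pose W w := \prod_(j | j != i) g j (X j w).
pose c := \prod_(j | j != i) m j.
have W0 w : 0 <= W w by apply: prodr_ge0.
have mW : measurable_fun setT W by exact: measurable_prodX.
have m0 j : 0 <= m j.
  rewrite -lee_fin; have [_ <-] := gm j.
  by apply: integral_ge0 => w _; rewrite lee_fin.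
have c0 : 0 <= c by apply: prodr_ge0.
apply: has_expectation_ge0.
- by move=> w; apply: prodr_ge0.
- exact: measurable_prodX.
under eq_integral => w _ do rewrite (bigD1 i)//= -/(W w) mulrC.
(* The product [W] of the other factors may be replaced by its mean [c]: it suffices to test this
   against indicators of [X i], where the induction hypothesis applies. *)
rewrite (@eq_weighted_integral _ _ _ _ _ _ _ P P W (cst c) (X i) (X i))//; last first.
  move=> B mB.
  pose g' j : R -> R := if j == i then \1_B else g j.
  pose m' j := if j == i then fine (P (X i @^-1` B)) else m j.
  have [_] : has_expectation (fun w => \prod_j g' j (X j w)) (\prod_j m' j).
    apply: ih => //.
    + by move=> j; rewrite /g'; case: ifP.
    + by move=> j y; rewrite /g'; case: ifP.
    + move=> j; rewrite /g' /m'; have [ji|//] := eqVneq j i; rewrite {}ji.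
      by apply: has_expectation_indic; exact: preim_measurable.
    + move=> j js; rewrite /g'; have [_|ji] := eqVneq j i.
        by exists B.
      by apply: gB; rewrite inE negb_or ji.
  rewrite (bigD1 i)//= {1}/m' eqxx (eq_bigr m); last first.
    by move=> j ji; rewrite /m' (negbTE ji).
  rewrite -/c mulrC => E.
  transitivity (c * fine (P (X i @^-1` B)))%:E.
    rewrite -E; apply: eq_integral => w _.
    rewrite (bigD1 i)//= {1}/g' eqxx mulrC; congr (_ * _)%:E.
    by apply: eq_bigr => j ji; rewrite /g' (negbTE ji).
  have [_] := has_expectationZ c (has_expectation_indic (preim_measurable i mB)).
  by move=> <-.
have [_ ->] := has_expectationZ c (gm i).
by rewrite (bigD1 i)//= mulrC.
Qed.

Lemma ge0_expectation_prod (g : I -> R -> R) (m : I -> R) :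
  (forall i, measurable_fun setT (g i)) -> (forall i y, 0 <= g i y) ->
  (forall i, has_expectation (fun w => g i (X i w)) (m i)) ->
  has_expectation (fun w => \prod_i g i (X i w)) (\prod_i m i).
Proof.
move=> mg g0 gm; apply: (@expectation_prod_rec (enum I)) => //.
  exact: enum_uniq.
by move=> i; rewrite mem_enum.
Qed.

(** Each factor is split into positive and negative part; expanding the product over all sign
    choices leaves products of nonnegative functions. *)
Lemma expectation_prod (g : I -> R -> R) (m : I -> R) :
  (forall i, measurable_fun setT (g i)) ->
  (forall i, has_expectation (fun w => g i (X i w)) (m i)) ->
  has_expectation (fun w => \prod_i g i (X i w)) (\prod_i m i).
Proof.
move=> mg gm.
pose h (b : bool) i : R -> R := if b then (g i)^\- else (g i)^\+.
have mh b i : measurable_fun setT (h b i).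
  by case: b; [exact: measurable_funrneg|exact: measurable_funrpos].
have h0 b i y : 0 <= h b i y by case: b; rewrite /h ?funrneg_ge0 ?funrpos_ge0.
have gE i y : g i y = \sum_(b : bool) (-1) ^+ b * h b i y.
  by rewrite big_bool /= expr1 expr0 mul1r mulN1r addrC -[in LHS](funrposBneg (g i)).
have hfin b i : exists v, has_expectation (fun w => h b i (X i w)) v.
  have [gi _] := gm i.
  have hi : P.-integrable setT (EFin \o (fun w => h b i (X i w))).
    case: b; first exact: (@integrable_funrneg _ _ _ P setT (fun w => g i (X i w))).
    exact: (@integrable_funrpos _ _ _ P setT (fun w => g i (X i w))).
  exists (fine (\int[P]_w (h b i (X i w))%:E)%E); split => //.
  by rewrite fineK//; exact: integrable_fin_num.
have /choice[mu muP] : forall bi : bool * I, exists v,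
    has_expectation (fun w => h bi.1 bi.2 (X bi.2 w)) v by move=> [b i]; exact: hfin.
have mE i : m i = \sum_(b : bool) (-1) ^+ b * mu (b, i).
  have : has_expectation (fun w => g i (X i w)) (\sum_(b : bool) (-1) ^+ b * mu (b, i)).
    apply: has_expectation_eq (@has_expectation_sum _ _ _
      (fun b w => (-1) ^+ (b : bool) * h b i (X i w)) _ _) => [w|//|b _].
      by rewrite gE.
    exact: has_expectationZ (muP (b, i)).
  by move=> [_]; have [_ ->] := gm i; case.
rewrite (eq_bigr _ (fun i _ => mE i)) bigA_distr_bigA/=.
apply: has_expectation_eq (@has_expectation_sum _ _ _ (fun (f : {ffun I -> bool}) w =>
   (\prod_i (-1) ^+ f i) * \prod_i h (f i) i (X i w)) _ _) => [w|//|f _].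
  under [RHS]eq_bigr do rewrite gE.
  by rewrite bigA_distr_bigA/=; apply: eq_bigr => f _; rewrite big_split.
rewrite /= [X in has_expectation _ X]big_split/=; apply: has_expectationZ.
apply: (@ge0_expectation_prod (fun i => h (f i) i)) => // i.
exact: muP (f i, i).
Qed.

End Independence.
End Expectation.

(** * Second and fourth moments of the centered normal density *)

Section NormalMoments.
Context {R : realType}.
Variable s : R.
Hypothesis s0 : 0 < s.
Notation mu := (@lebesgue_measure R).
Notation p := (normal_pdf 0 s).

Let pE x : p x = normal_peak s * expR (- x ^+ 2 / (s ^+ 2 *+ 2)).
Proof. by rewrite normal_pdfE ?gt_eqF// /normal_fun subr0. Qed.

Let is_derive_pdf (x : R) : is_derive x (1:R) p (- (x / s ^+ 2) * p x).
Proof.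
have -> : p = (fun x => normal_peak s * expR (- (s ^+ 2 *+ 2)^-1 * x ^+ 2)).
  by apply/funext => y; rewrite pE mulNr mulNr (mulrC (y ^+ 2)).
apply: is_derive_eq.
rewrite /GRing.scale/=.
field.
by rewrite gt_eqF.
Qed.

Let is_derive_pow_pdf j (x : R) :
  is_derive x (1:R) (fun y => y ^+ j.+1 * p y)
    (j.+1%:R * x ^+ j * p x - x ^+ j.+2 / s ^+ 2 * p x).
Proof.
have dX : is_derive x (1:R) ((@id R) ^+ j.+1) ((j.+1%:R * x ^+ j) *: (1:R)).
  exact: is_deriveX.
have := @is_deriveM _ _ _ _ x 1 _ _ dX (is_derive_pdf x).
have -> : ((@id R) ^+ j.+1 * p) = (fun y => y ^+ j.+1 * p y).
  by apply/funext => y; rewrite fctE/= exprfctE.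
move=> H; apply: is_derive_eq.
rewrite exprfctE /GRing.scale/= !exprS; field.
by rewrite gt_eqF.
Qed.

Let continuous_pow_pdf j : continuous (fun x : R => x ^+ j * p x).
Proof.
move=> x; apply: cvgM; first exact: exprn_continuous.
by apply: continuous_normal_pdf; rewrite gt_eqF.
Qed.

(** This removes the boundary term of the integration by parts. *)
Let pow_pdf_cvg0 k : ((n%:R : R) ^+ k * p n%:R) @[n --> \oo] --> (0 : R).
Proof.
(* With [y = n ^+ 2 / (s ^+ 2 *+ 2)], the exponential series gives [expR y >= y ^+ k.+1 / (k.+1)!].
   Hence the sequence is at most [C / n ^+ k.+2], and a fortiori [C / n]. *)
pose C := normal_peak s * (k.+1)`!%:R * (s ^+ 2 *+ 2) ^+ k.+1.
have C0 : 0 <= C.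
  by rewrite !mulr_ge0 ?normal_peak_ge0// exprn_ge0// mulrn_wge0 ?sqr_ge0.
have cC : (C * (n.+1%:R)^-1) @[n --> \oo] --> (0 : R).
  by rewrite -(mulr0 C); apply: cvgMr; exact: cvg_harmonic.
rewrite -cvg_shiftS/=.
apply: (squeeze_cvgr _ (cvg_cst 0) cC).
near=> n; apply/andP; split.
  by rewrite mulr_ge0// ?exprn_ge0// normal_pdf_ge0.
rewrite pE mulNr expRN; set y := _ ^+ 2 / _.
have n0 : 0 < n.+1%:R :> R by rewrite ltr0n.
have ss0 : 0 < s ^+ 2 *+ 2 by rewrite mulrn_wgt0// exprn_gt0.
have y0 : 0 < y by rewrite divr_gt0// exprn_gt0.
have ey : y ^+ k.+1 / (k.+1)`!%:R <= expR y.
  by apply: le_trans (expR_ge1Dxn k (ltW y0)); rewrite lerDr.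
have f0 : 0 < (k.+1)`!%:R :> R by rewrite ltr0n fact_gt0.
apply: (@le_trans _ _ (n.+1%:R ^+ k * (normal_peak s * (y ^+ k.+1 / (k.+1)`!%:R)^-1))).
  rewrite ler_wpM2l ?exprn_ge0// ler_wpM2l ?normal_peak_ge0//.
  by rewrite lef_pV2 ?posrE ?expR_gt0 ?divr_gt0// ?exprn_gt0.
rewrite invf_div /y expr_div_n invf_div /C.
rewrite [leLHS](_ : _ = normal_peak s * (k.+1)`!%:R * (s ^+ 2 *+ 2) ^+ k.+1 *
   (n.+1%:R ^+ k / (n.+1%:R ^+ 2) ^+ k.+1)); last by rewrite -!mulrA; ring.
rewrite ler_wpM2l// -exprM (_ : (2 * k.+1 = k + k.+2)%N); last first.
  by rewrite mul2n -addnn addSnnS.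
rewrite exprD invfM mulrA divff ?gt_eqF ?exprn_gt0// ?mul1r.
rewrite lef_pV2 ?posrE ?exprn_gt0// exprS ler_peMr ?ler0n//.
by rewrite exprn_ege1// ler1n.
Unshelve. all: by end_near.
Qed.

Let half_moment j := (\int[mu]_(x in `[0%R, +oo[) (x ^+ j * p x)%:E)%E.

Let integrable_itv j (n : nat) :
  mu.-integrable `[0, n%:R] (EFin \o (fun x : R => x ^+ j * p x)).
Proof.
apply: continuous_compact_integrable; first exact: segment_compact.
apply: continuous_subspaceT => x; exact: continuous_pow_pdf.
Qed.

(** The fundamental theorem of calculus for [x ^+ j.+1 * p x], whose derivative combines the two
    integrands. Compactness of the interval makes both terms integrable, so the integral of the
    difference splits. *)
Let pow_pdf_by_parts j (n : nat) : (0 < n)%N ->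
  (\int[mu]_(x in `[0%R, n%:R]) (x ^+ j.+2 * p x)%:E =
   (s ^+ 2 * j.+1%:R)%:E * \int[mu]_(x in `[0%R, n%:R]) (x ^+ j * p x)%:E
   - (s ^+ 2 * (n%:R ^+ j.+1 * p n%:R))%:E)%E.
Proof.
move=> n0.
pose F (x : R) := x ^+ j.+1 * p x.
pose f (x : R) := j.+1%:R * (x ^+ j * p x) - s ^- 2 * (x ^+ j.+2 * p x).
have dF x : is_derive x (1:R) F (f x).
  by apply: is_derive_eq (is_derive_pow_pdf j x) _; rewrite /f; ring.
have cf : continuous f.
  by move=> x; apply: cvgB; apply: cvgMr; exact: continuous_pow_pdf.
have cF : continuous F by exact: continuous_pow_pdf.
have := @continuous_FTC2 R f F 0 n%:R.
rewrite ltr0n => /(_ n0 (continuous_subspaceT cf)) FTC.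
have {FTC} : (\int[mu]_(x in `[0%R, n%:R]) (f x)%:E = (F n%:R)%:E)%E.
  rewrite FTC.
  - by rewrite /F expr0n/= mul0r sube0.
  - split.
    + by move=> x _; apply: ex_derive.
    + by apply: cvg_at_right_filter; exact: cF.
    + by apply: cvg_at_left_filter; exact: cF.
  - by move=> x _; rewrite derive1E; exact: derive_val.
rewrite /f; under eq_integral do rewrite EFinB EFinM (EFinM (s ^- 2)).
rewrite integralB//=; last 2 first.
- exact: (integrableZl _ j.+1%:R (integrable_itv j n)).
- exact: (integrableZl _ (s ^- 2) (integrable_itv j.+2 n)).
rewrite integralZl//; last exact: integrable_itv.
rewrite integralZl//; last exact: integrable_itv.
have I0 k : exists r, (\int[mu]_(x in `[0%R, n%:R]) (x ^+ k * p x)%:E = r%:E)%E.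
  exists (fine (\int[mu]_(x in `[0%R, n%:R]) (x ^+ k * p x)%:E)).
  by rewrite fineK//; exact: integrable_fin_num (integrable_itv k n).
have [a ->] := I0 j; have [b ->] := I0 j.+2.
rewrite -!EFinM -!EFinB => -[ab]; congr EFin.
have -> : b = s ^+ 2 * (s ^- 2 * b) by rewrite mulrA divff ?mul1r// gt_eqF// exprn_gt0.
by rewrite -/(F n%:R) -ab; ring.
Qed.

(** The truncated recursion passes to the limit: evenness of [j] makes the integrands nonnegative on
    the whole line, so the truncated integrals converge monotonically. *)
Let half_momentS j c : ~~ odd j -> half_moment j = c%:E ->
  half_moment j.+2 = (s ^+ 2 * j.+1%:R * c)%:E.
Proof.
move=> oj jc.
have cvgH k : ~~ odd k ->
    (\int[mu]_(x in `[0%R, n%:R]) (x ^+ k * p x)%:E)%E @[n --> \oo] -->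
    half_moment k.
  move=> ok; apply: (@ge0_cvgn_integral _ mu (fun x : R => x ^+ k * p x)).
    by move=> x; rewrite mulr_ge0 ?normal_pdf_ge0 ?exprn_even_ge0.
  by apply: continuous_measurable_fun; exact: continuous_pow_pdf.
have := cvgH j.+2; rewrite /= negbK => /(_ oj) cvg2.
apply: (cvg_unique _ cvg2) => //.
have cvgR : ((s ^+ 2 * j.+1%:R)%:E * (\int[mu]_(x in `[0%R, n%:R]) (x ^+ j * p x)%:E)
    - (s ^+ 2 * (n%:R ^+ j.+1 * p n%:R))%:E)%E @[n --> \oo] -->
    ((s ^+ 2 * j.+1%:R * c)%:E - (s ^+ 2 * 0)%:E)%E.
  apply: cvgeB => //.
    rewrite [X in _ --> X]EFinM -jc; apply: cvgeZl => //; exact: cvgH.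
  by apply: cvg_EFin; [exact: nearW|apply: cvgMr; exact: pow_pdf_cvg0].
rewrite mulr0 sube0 in cvgR.
apply: cvg_trans cvgR; apply: near_eq_cvg.
near=> n; rewrite pow_pdf_by_parts//.
by near: n; exact: nbhs_infty_gt.
Unshelve. all: by end_near.
Qed.

Let normal_pdf_even_moment j c : ~~ odd j -> half_moment j = c%:E ->
  (\int[mu]_x (x ^+ j * p x)%:E = (2 * c)%:E)%E.
Proof.
move=> oj jc.
rewrite ge0_symfun_integralT//=.
- rewrite (_ : [set x | _] = `[0, +oo[%classic); last first.
    by apply/seteqP; split => x/=; rewrite in_itv/= andbT.
  by rewrite EFinM -jc.
- by move=> x; rewrite mulr_ge0 ?normal_pdf_ge0 ?exprn_even_ge0.
- by move=> x /=; rewrite !pE sqrrN exprNn -signr_odd (negbTE oj) mul1r.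
Qed.

Let half_moment0 : half_moment 0 = (2^-1)%:E.
Proof.
have := integral_normal_pdf 0 s.
rewrite ge0_symfun_integralT//=; last 3 first.
- by move=> x; exact: normal_pdf_ge0.
- by apply: continuous_normal_pdf; rewrite gt_eqF.
- by move=> x /=; rewrite !pE sqrrN.
rewrite (_ : [set x | _] = `[0, +oo[%classic); last first.
  by apply/seteqP; split => x/=; rewrite in_itv/= andbT.
rewrite /half_moment; under [in X in _ -> X]eq_integral do rewrite expr0 mul1r.
case: (integral _ _ _) => [r [E]| |].
- by congr EFin; rewrite -[r](mulKf (_ : 2 != 0)) ?E ?mulr1.
- by rewrite mulry gtr0_sg ?mul1e.
- by rewrite mulrNy gtr0_sg ?mul1e.
Qed.

Lemma normal_pdf_moment2 : (\int[mu]_x (x ^+ 2 * p x)%:E = (s ^+ 2)%:E)%E.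
Proof.
rewrite (normal_pdf_even_moment _ (half_momentS _ half_moment0))//.
by congr EFin; field.
Qed.

Lemma normal_pdf_moment4 : (\int[mu]_x (x ^+ 4 * p x)%:E = (3 * s ^+ 4)%:E)%E.
Proof.
rewrite (normal_pdf_even_moment _ (half_momentS _ (half_momentS _ half_moment0)))//.
by congr EFin; field.
Qed.

End NormalMoments.

(** Moments of a centered Gaussian of variance [v]. The last branch covers the odd moments 1 and 3;
    above 4 its value is a mere default, and [gaussian_moment] stops at 4. *)
Definition gauss_moment {R : realType} (v : R) (e : nat) : R :=
  match e with 0 => 1 | 2 => v | 4 => 3 * v ^+ 2 | _ => 0 end.

(** * Moments of a Gaussian random variable up to order four *)

Section GaussianVariable.
Context {R : realType} {dT : measure_display} {T : measurableType dT}.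
Variables (P : probability T R) (X : T -> R) (v : R).
Hypotheses (v0 : 0 < v) (gX : centered_gaussian P X v).
Notation mu := (@lebesgue_measure R).
Notation s := (Num.sqrt v).
Notation p := (normal_pdf 0 s).

Let mX : measurable_fun setT X. Proof. by case: gX. Qed.

Let s0 : 0 < s. Proof. by rewrite sqrtr_gt0. Qed.

Let preim_measurable (B : set R) : measurable B -> measurable (X @^-1` B).
Proof. by move=> mB; rewrite -[X in measurable X]setTI; exact: mX. Qed.

Let law_indic (B : set R) : measurable B ->
  (\int[P]_w (1 * \1_B (X w))%:E = \int[mu]_x (p x * \1_B x)%:E)%E.
Proof.
move=> mB; under eq_integral do rewrite mul1r.
rewrite -[LHS]/(\int[P]_w (\1_(X @^-1` B) w)%:E)%E.
rewrite integral_indic ?setIT//; last exact: preim_measurable.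
transitivity (normal_prob 0 s B); first exact: (gX.2 B mB).
rewrite /normal_prob integral_mkcond.
apply: eq_integral => x _; rewrite patchE indicE.
by case: ifPn; rewrite ?mulr1 ?mulr0.
Qed.

(** The law is given on sets only; [eq_weighted_integral] with weights 1 and [p] extends it to
    nonnegative functions. *)
Let law_ge0 (g : R -> R) : measurable_fun setT g -> (forall x, 0 <= g x) ->
  (\int[P]_w (g (X w))%:E = \int[mu]_x (p x * g x)%:E)%E.
Proof.
move=> mg g0.
rewrite -(@eq_weighted_integral _ _ _ _ _ _ _ P mu (cst 1) p X id)//.
- by apply: eq_integral => w _; rewrite /= mul1r.
- by move=> x; exact: normal_pdf_ge0.
- exact: measurable_normal_pdf.
Qed.

Let law_sym (g : R -> R) : measurable_fun setT g -> (forall x, 0 <= g x) ->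
  (\int[P]_w (g (X w))%:E = \int[P]_w (g (- X w))%:E)%E.
Proof.
move=> mg g0; rewrite law_ge0// (law_ge0 (g := g \o -%R))//; last 2 first.
- exact: measurableT_comp.
- by move=> x; exact: g0.
have mpg : measurable_fun setT (EFin \o (fun x => p x * g x)).
  by apply/measurable_EFinP/measurable_funM => //; exact: measurable_normal_pdf.
(* Lebesgue measure equals its image under negation, and the density is even. *)
transitivity (\int[pushforward mu (-%R : R -> measurableTypeR R)]_x (p x * g x)%:E)%E.
  by apply: eq_measure_integral => A mA _; exact/esym/lebesgue_measureN.
rewrite (@ge0_integral_pushforward _ _ (measurableTypeR R) (measurableTypeR R) R
  -%R (@oppr_measurable R setT) mu setT (EFin \o (fun x : R => p x * g x))
  measurableT mpg); last first.
  by move=> x _; rewrite lee_fin mulr_ge0// normal_pdf_ge0.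
rewrite preimage_setT.
apply: eq_integral => x _ /=.
by rewrite !normal_pdfE ?gt_eqF// /normal_fun !subr0 sqrrN.
Qed.

Let measurable_pow e : measurable_fun setT (fun x : R => x ^+ e).
Proof. exact: measurable_funX. Qed.

Let moment2 : has_expectation P (fun w => X w ^+ 2) v.
Proof.
apply: has_expectation_ge0 => [w||]; first exact: sqr_ge0.
  exact: (measurableT_comp (measurable_pow 2)).
rewrite (law_ge0 (g := fun x => x ^+ 2))//; last by move=> x; exact: sqr_ge0.
under eq_integral do rewrite mulrC.
by rewrite normal_pdf_moment2// sqr_sqrtr// ltW.
Qed.

Let moment4 : has_expectation P (fun w => X w ^+ 4) (3 * v ^+ 2).
Proof.
have e4 (x : R) : 0 <= x ^+ 4 by exact: exprn_even_ge0.
apply: has_expectation_ge0 => [w//||].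
  exact: (measurableT_comp (measurable_pow 4)).
rewrite (law_ge0 (g := fun x => x ^+ 4))//.
under eq_integral do rewrite mulrC.
by rewrite normal_pdf_moment4// (exprM _ 2 2) sqr_sqrtr// ltW.
Qed.

Let odd_moment e : (e <= 4)%N -> odd e -> has_expectation P (fun w => X w ^+ e) 0.
Proof.
move=> e4 oe.
have mXe : measurable_fun setT (fun w => X w ^+ e).
  exact: (measurableT_comp (measurable_pow e)).
have iX : P.-integrable setT (EFin \o (fun w => X w ^+ e)).
  (* The dominating function is [1 + X ^+ 4]: the 1 covers [|X| <= 1], the fourth power the rest. *)
  have [i4 _] := has_expectationD (has_expectation_cst P 1) moment4.
  apply: le_integrable i4 => //; first exact/measurable_EFinP.
  move=> w _ /=; rewrite lee_fin [leRHS]ger0_norm; last first.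
    by rewrite addr_ge0// exprn_even_ge0.
  rewrite normrX -[X w ^+ 4]ger0_norm ?exprn_even_ge0// normrX.
  have [x1|/ltW x1] := leP `|X w| 1.
    by rewrite (le_trans (exprn_ile1 _ _ x1))// lerDl exprn_ge0.
  by rewrite (le_trans (ler_weXn2l x1 e4))// lerDr.
split => //.
rewrite integralE/=.
rewrite (_ : (fun w => (X w ^+ e)%:E) = EFin \o (fun w => X w ^+ e))//.
rewrite funerpos funerneg.
have := @law_sym (fun x => x ^+ e)^\+%R.
rewrite -[X in measurable_fun _ X]/(fun x : R => x ^+ e)^\+%R.
move=> /(_ (measurable_funrpos (measurable_pow e)) (funrpos_ge0 _)).
move=> E.
(* For odd [e], negating [X] exchanges the positive and negative parts of its power, so by symmetry
   they have the same integral. *)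
have -> : (\int[P]_x (EFin \o (fun w => X w ^+ e)^\+%R) x =
          \int[P]_x (EFin \o (fun w => X w ^+ e)^\-%R) x)%E.
  rewrite [LHS]E; apply: eq_integral => w _ /=; congr EFin.
  by rewrite /funrpos /funrneg exprNn -signr_odd oe expr1 mulN1r.
rewrite subee//.
apply: integrable_fin_num => //; exact: integrable_funrneg.
Qed.

Lemma gaussian_moment e : (e <= 4)%N ->
  has_expectation P (fun w => X w ^+ e) (gauss_moment v e).
Proof.
move: e => [|[|[|[|[|//]]]]] _ /=.
- exact: has_expectation_cst.
- exact: odd_moment.
- exact: moment2.
- exact: odd_moment.
- exact: moment4.
Qed.

End GaussianVariable.

(** * Sums over dependent finite functions *)

Section DependentSums.
Variable R : comNzRingType.

(** Distributivity when the index type varies with the factor. It is reduced to the non-dependent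
    law by viewing choices as functions into a tagged union. *)
Lemma prod_sum_dffun (I : finType) (T_ : I -> finType) (F : forall i, T_ i -> R) :
  \prod_i \sum_(j : T_ i) F i j =
  \sum_(f : {dffun forall i, T_ i}) \prod_i F i (f i).
Proof.
pose F' i : {ffun T_ i -> R} := [ffun j => F i j].
rewrite (reindex (@dffun_of_fprod _ T_)); last exact/onW_bij/dffun_of_fprod_bij.
have -> : \sum_j \prod_i F i (dffun_of_fprod j i) =
    \sum_(t : fprod T_) \prod_(i in I) F' i (t i).
  by apply: eq_bigr => t _; apply: eq_bigr => i _; rewrite !ffunE.
rewrite big_fprod.
rewrite (eq_bigr (fun i => \sum_(j in tagged_with T_ i) untag 0 (F' i) j)).
  by rewrite bigA_distr_big_dep.
move=> i _; rewrite -(big_tag (fun i => F' i) i).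
by apply: eq_bigr => j _; rewrite ffunE.
Qed.

Lemma pair_big_dffun (I : finType) (X Y : I -> finType)
    (G : {dffun forall i, X i} -> {dffun forall i, Y i} -> R) :
  \sum_a \sum_b G a b =
  \sum_(c : {dffun forall i, (X i * Y i)%type})
    G [ffun i => (c i).1] [ffun i => (c i).2].
Proof.
rewrite pair_bigA/=.
pose to (c : {dffun forall i, (X i * Y i)%type}) :
    {dffun forall i, X i} * {dffun forall i, Y i} :=
  ([ffun i => (c i).1], [ffun i => (c i).2]).
pose of' (ab : {dffun forall i, X i} * {dffun forall i, Y i}) :
    {dffun forall i, (X i * Y i)%type} := [ffun i => (ab.1 i, ab.2 i)].
rewrite (reindex to)//; exists of' => [c _|[a b] _].
  by apply/ffunP => i; rewrite !ffunE; case: (c i).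
by congr pair; apply/ffunP => i; rewrite !ffunE.
Qed.

End DependentSums.

(** * Cyclic tensor contractions *)

Section Chain.
Variables (R : comNzRingType) (n : nat).

(** For fixed [s] the inner sum is the trace of a cyclic product of matrices. Index types are free
    so that several copies of the network form again a chain. *)
Definition chain (S X : 'I_n -> finType)
    (f : forall l, S l -> X l -> X (ordS l) -> R) : R :=
  \sum_(s : {dffun forall l, S l}) \sum_(a : {dffun forall l, X l})
    \prod_l f l (s l) (a l) (a (ordS l)).

Lemma eq_chain (S X : 'I_n -> finType) (f g : forall l, S l -> X l -> X (ordS l) -> R) :
  (forall l s a b, f l s a b = g l s a b) -> chain f = chain g.
Proof. by move=> fg; do 3!apply: eq_bigr => ? _; exact: fg. Qed.

Lemma chain_mul (S X S' X' : 'I_n -> finType)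
    (f : forall l, S l -> X l -> X (ordS l) -> R)
    (g : forall l, S' l -> X' l -> X' (ordS l) -> R) :
  chain f * chain g =
  chain (S := fun l => (S l * S' l)%type) (X := fun l => (X l * X' l)%type)
    (fun l s a b => f l s.1 a.1 b.1 * g l s.2 a.2 b.2).
Proof.
rewrite /chain big_distrlr/= pair_big_dffun; apply: eq_bigr => s _.
rewrite big_distrlr/= pair_big_dffun; apply: eq_bigr => a _.
by rewrite -big_split/=; apply: eq_bigr => l _; rewrite !ffunE.
Qed.

(** Once each site is expanded over its label [p], the bond indices decouple: the bond entering site
    [l] meets only the labels of [l] and of its predecessor. *)
Lemma chain_transfer (S X : 'I_n -> finType) (Pi : finType)
    (g : forall l, Pi -> S l -> R) (h : forall l, Pi -> X l -> R) :
  chain (fun l s a b => \sum_(p : Pi) g l p s * h l p a * h (ordS l) p b) =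
  \sum_(p : {ffun 'I_n -> Pi}) \prod_l ((\sum_s g l (p l) s) *
     (\sum_a h l (p l) a * h l (p (ord_pred l)) a)).
Proof.
rewrite /chain.
under eq_bigr => s _ do under eq_bigr => a _ do rewrite bigA_distr_bigA.
under eq_bigr => s _ do rewrite exchange_big.
rewrite exchange_big; apply: eq_bigr => p _ /=.
rewrite big_split/= prod_sum_dffun prod_sum_dffun big_distrlr/=.
apply: eq_bigr => s _; apply: eq_bigr => a _.
rewrite !big_split/= mulrA; congr (_ * _).
(* The outgoing bond of site [l] is the incoming bond of [ordS l], hence the cyclic shift. *)
rewrite [RHS](reindex_inj (can_inj (@ordSK n)))/=.
by apply: eq_bigr => l _; rewrite ordSK.
Qed.

End Chain.

(** * Pairings of four copies *)

Section Wick.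
Variable R : comNzRingType.

(* The three pairings of four copies [((q1, q2), (q3, q4))]: [None] is 12|34,
   [Some false] is 13|24 and [Some true] is 14|23. *)
Definition paired (X : eqType) (p : option bool) (q : (X * X) * (X * X)) : bool :=
  match p with
  | None => (q.1.1 == q.1.2) && (q.2.1 == q.2.2)
  | Some false => (q.1.1 == q.2.1) && (q.1.2 == q.2.2)
  | Some true => (q.1.1 == q.2.2) && (q.1.2 == q.2.1)
  end.

Lemma paired_pair (X Y : eqType) p (x : (X * X) * (X * X)) (y : (Y * Y) * (Y * Y)) :
  paired p (((x.1.1, y.1.1), (x.1.2, y.1.2)), ((x.2.1, y.2.1), (x.2.2, y.2.2))) =
  paired p x && paired p y.
Proof. by case: p => [[]|] /=; rewrite !xpair_eqE; exact: andbACA. Qed.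

(** Equal pairings leave two free indices; two distinct pairings identify all four copies and leave
    one. This loss of a factor [#|X|] is the source of every [1 / D_l]. *)
Lemma sum_paired2 (X : finType) (p p' : option bool) :
  \sum_(q : (X * X) * (X * X)) (paired p q)%:R * (paired p' q)%:R =
  (if p == p' then #|X| ^ 2 else #|X|)%N%:R :> R.
Proof.
have card1 (y : X) : \sum_x (x == y)%:R = 1 :> R.
  by rewrite (bigD1 y)//= eqxx big1 ?addr0// => x /negbTE ->.
have E : \sum_(q : (X * X) * (X * X)) (paired p q)%:R * (paired p' q)%:R =
   \sum_(q1 : X) \sum_(q2 : X) \sum_(q3 : X) \sum_(q4 : X)
     (paired p ((q1, q2), (q3, q4)) && paired p' ((q1, q2), (q3, q4)))%:R :> R.
  rewrite -(pair_bigA _ (fun u v => (paired p (u, v))%:R * (paired p' (u, v))%:R))/=.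
  rewrite -(pair_bigA _ (fun x y => \sum_v (paired p ((x, y), v))%:R *
     (paired p' ((x, y), v))%:R))/=.
  apply: eq_bigr => q1 _; apply: eq_bigr => q2 _.
  rewrite -(pair_bigA _ (fun z t => (paired p ((q1, q2), (z, t)))%:R *
     (paired p' ((q1, q2), (z, t)))%:R))/=.
  by apply: eq_bigr => q3 _; apply: eq_bigr => q4 _; rewrite -mulnb natrM.
rewrite E {E}.
have card1' (y : X) : \sum_x (y == x)%:R = 1 :> R.
  by rewrite -[RHS](card1 y); apply: eq_bigr => x _; rewrite eq_sym.
have cardX : \sum_(x : X) 1 = #|X|%:R :> R by rewrite sumr_const.
case: eqP => [<-|pp'].
  rewrite natrX expr2 -[in RHS]cardX mulr_suml; apply: eq_bigr => q1 _.
  rewrite mul1r.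
  case: p => [[]|] /=.
  - apply: eq_bigr => q2 _; rewrite -[RHS](card1' q2).
    apply: eq_bigr => q3 _; rewrite -[RHS]mul1r -[X in _ = X * _](card1' q1) mulr_suml.
    by apply: eq_bigr => q4 _; rewrite andbb -mulnb natrM.
  - apply: eq_bigr => q2 _; rewrite -[RHS](card1' q1).
    apply: eq_bigr => q3 _; rewrite -[RHS]mulr1 -[X in _ = _ * X](card1' q2) mulr_sumr.
    by apply: eq_bigr => q4 _; rewrite andbb -mulnb natrM.
  - rewrite -[RHS]mul1r -[X in _ = X * _](card1' q1) mulr_suml; apply: eq_bigr => q2 _.
    rewrite mulr_sumr; apply: eq_bigr => q3 _.
    by rewrite -[X in _ = _ * X](card1' q3) mulr_sumr; apply: eq_bigr => q4 _; rewrite andbb -mulnb natrM.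
have E q1 q2 q3 q4 : paired p ((q1, q2), (q3, q4)) && paired p' ((q1, q2), (q3, q4)) =
   [&& q2 == q1, q3 == q1 & q4 == q1 :> X].
  apply/idP/idP.
    by move: p p' pp' => [[]|] [[]|] //= _
      /andP[/andP[/eqP e1 /eqP e2] /andP[/eqP e3 /eqP e4]]; subst; rewrite !eqxx.
  by move=> /and3P[/eqP-> /eqP-> /eqP->]; move: (p) (p') => [[]|] [[]|] /=; rewrite !eqxx.
rewrite -cardX; apply: eq_bigr => q1 _; rewrite -[RHS](card1 q1).
apply: eq_bigr => q2 _; rewrite -[RHS]mulr1 -[X in _ = _ * X](card1 q1) mulr_sumr.
apply: eq_bigr => q3 _; rewrite -[RHS]mulr1 -[X in _ = _ * X](card1 q1) mulr_sumr.
by apply: eq_bigr => q4 _; rewrite E -!natrM !mulnb andbA.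
Qed.

End Wick.

(** * Wick's formula for two and four entries of one tensor *)

Section WickMoments.
Variables (R : realType) (J : finType).

(** Writing a single entry as a product over all entries turns a product of entries into a sum of
    exponents, to which independence applies. *)
Lemma prod_expr_eq (F : J -> R) q : \prod_j F j ^+ (q == j) = F q.
Proof.
rewrite (bigD1 q)//= eqxx expr1 big1 ?mulr1// => j.
by rewrite eq_sym => /negbTE ->.
Qed.

Let prod_zero (g : J -> R) x : g x = 0 -> \prod_j g j = 0.
Proof. by move=> gx; rewrite (bigD1 x)//= gx mul0r. Qed.

Let prod_two (g : J -> R) x y : x != y ->
  (forall j, x != j -> y != j -> g j = 1) -> \prod_j g j = g x * g y.
Proof.
move=> xy g1; rewrite (bigD1 x)//= (bigD1 y) 1?eq_sym//= big1 ?mulr1//.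
by move=> j /andP[jx jy]; apply: g1; rewrite eq_sym.
Qed.

Let prod_one (g : J -> R) x : (forall j, x != j -> g j = 1) -> \prod_j g j = g x.
Proof.
move=> g1; rewrite (bigD1 x)//= big1 ?mulr1// => j jx; apply: g1.
by rewrite eq_sym.
Qed.

Lemma moment_pair (v : R) (q1 q2 : J) :
  \prod_j gauss_moment v ((q1 == j) + (q2 == j)) = v * (q1 == q2)%:R.
Proof.
have [<-|q12] := eqVneq q1 q2.
  rewrite (prod_one (x := q1)) => [|j /negbTE -> //].
  by rewrite eqxx mulr1.
rewrite mulr0; apply: (prod_zero (x := q1)).
by rewrite eqxx eq_sym (negbTE q12).
Qed.

Lemma sum_option_bool (F : option bool -> R) :
  \sum_p F p = F None + (F (Some false) + F (Some true)).
Proof.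
rewrite (bigD1 None)//= (bigD1 (Some false))//= (bigD1 (Some true))//=.
by rewrite big1 ?addr0// => -[[]|].
Qed.

(** The exponent of [j] counts the copies equal to [j]. Four equal copies give [3 * v ^+ 2], one
    [v ^+ 2] per pairing; two distinct pairs give [v ^+ 2] for the only matching pairing; otherwise
    some index occurs an odd number of times and both sides vanish. *)
Lemma moment_wick (v : R) (q : (J * J) * (J * J)) :
  \prod_j gauss_moment v ((q.1.1 == j) + (q.1.2 == j) + ((q.2.1 == j) + (q.2.2 == j)))
  = \sum_p v ^+ 2 * (paired p q)%:R.
Proof.
case: q => -[q1 q2] [q3 q4]; rewrite sum_option_bool/=.
have [<-{q2}|q12] := eqVneq q1 q2.
  have [<-{q4}|q34] := eqVneq q3 q4.
    have [<-{q3}|q13] := eqVneq q1 q3.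
      rewrite (prod_one (x := q1)) => [|j /negbTE -> //].
      by rewrite !eqxx /=; ring.
    rewrite (prod_two (x := q1) (y := q3))//; last first.
      by move=> j /negbTE -> /negbTE ->.
    by rewrite !eqxx (negbTE q13) eq_sym (negbTE q13)/=; ring.
  rewrite [LHS](_ : _ = 0); last first.
    have [q31|q31] := eqVneq q3 q1.
      apply: (prod_zero (x := q1)).
      by rewrite q31 eqxx eq_sym -q31 (negbTE q34).
    have [q41|q41] := eqVneq q4 q1.
      apply: (prod_zero (x := q1)).
      by rewrite q41 eqxx (negbTE q31).
    apply: (prod_zero (x := q3)).
    by rewrite eqxx eq_sym (negbTE q31) eq_sym (negbTE q34).
  have [q13|] := eqVneq q1 q3; have [q14|] := eqVneq q1 q4 => /=; last by move=> *; ring.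
  - by rewrite -q13 q14 eqxx in q34.
  - by move=> _; ring.
  - by move=> _; ring.
rewrite /=.
have [<-{q3}|q13] := eqVneq q1 q3.
  rewrite [q2 == q1]eq_sym (negbTE q12) andbF/=.
  have [<-{q4}|q24] := eqVneq q2 q4.
    rewrite (prod_two (x := q1) (y := q2))//; last first.
      by move=> j /negbTE -> /negbTE ->.
    by rewrite !eqxx (negbTE q12) eq_sym (negbTE q12)/=; ring.
  rewrite [LHS](_ : _ = 0); first by rewrite /= ?andbF /=; ring.
  apply: (prod_zero (x := q2)).
  by rewrite eqxx (negbTE q12) eq_sym (negbTE q24).
have [<-{q4}|q14] := eqVneq q1 q4.
  have [<-{q3 q13}|q23] := eqVneq q2 q3.
    rewrite (prod_two (x := q1) (y := q2))//; last first.
      by move=> j /negbTE -> /negbTE ->.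
    by rewrite !eqxx (negbTE q12) eq_sym (negbTE q12)/=; ring.
  rewrite [LHS](_ : _ = 0); first by rewrite /= ?andbF /=; ring.
  apply: (prod_zero (x := q2)).
  by rewrite eqxx (negbTE q12) eq_sym (negbTE q23).
rewrite [LHS](_ : _ = 0); first by rewrite /= ?andbF /=; ring.
apply: (prod_zero (x := q1)).
by rewrite eqxx ![_ == q1]eq_sym (negbTE q12) (negbTE q13) (negbTE q14).
Qed.

End WickMoments.

(** * The kernel as a sum of two-copy chains *)

Section NTKChain.
Variables (R : realType) (n : nat) (d D : 'I_n -> nat).
Variables (phi : forall k : 'I_n, R -> 'I_(d k) -> R) (A : mps_idx d D -> R).
Implicit Types (x : 'I_n -> R) (i : mps_idx d D).

Lemma entry_eq_tag (l : 'I_n) (s : 'I_(d l)) (a : 'I_(D l)) (b : 'I_(D (ordS l))) i :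
  l != tag i -> (entry s a b == i) = false.
Proof. by apply: contraNF => /eqP <-. Qed.

(* [mps_out] is affine in the single parameter [A i]. *)
Lemma dmps_chain x i : dmps phi A x i =
  chain (fun l (s : 'I_(d l)) (a : 'I_(D l)) (b : 'I_(D (ordS l))) =>
    (if l == tag i then (entry s a b == i)%:R else A (entry s a b)) * @phi l (x l) s).
Proof.
set C1 := chain _.
pose C0 := chain (fun l (s : 'I_(d l)) (a : 'I_(D l)) (b : 'I_(D (ordS l))) =>
  upd A i 0 (entry s a b) * @phi l (x l) s).
have E t : mps_out phi (upd A i t) x = C0 + t * C1.
  rewrite /mps_out /C0 /C1 /chain mulr_sumr -big_split/=.
  apply: eq_bigr => s _; rewrite mulr_sumr -big_split/=; apply: eq_bigr => a _.
  rewrite -big_split/=.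
  (* The parameter [A i] can occur only at site [tag i], so this factor is isolated and the others
     do not depend on [t]. *)
  rewrite (bigD1 (tag i))//= [X in _ = X + _](bigD1 (tag i))//=.
  rewrite [X in _ = _ + t * X](bigD1 (tag i))//= eqxx.
  set e := entry _ _ _.
  rewrite [X in _ = _ + t * (_ * X)](eq_bigr (fun l =>
      upd A i t (entry (s l) (a l) (a (ordS l))) * @phi l (x l) (s l))); last first.
    by move=> l li; rewrite (negbTE li) /upd entry_eq_tag.
  rewrite [X in _ = _ * X + _](eq_bigr (fun l =>
      upd A i t (entry (s l) (a l) (a (ordS l))) * @phi l (x l) (s l))); last first.
    by move=> l li; rewrite /upd !entry_eq_tag.
  by rewrite /upd; case: eqP => _ /=; ring.
rewrite /dmps (_ : (fun t => _) = (fun t => C0 + t * C1)); last exact/funext.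
rewrite derive1E; have -> : 'D_1 (fun t : R => C0 + t * C1) (A i) = 0 + (1 * C1).
  apply: derive_val; apply: is_derive_eq.
  by rewrite /GRing.scale/=; ring.
by rewrite add0r mul1r.
Qed.

(** Differentiating both copies in the same entry of tensor [k] and summing over that entry glues
    the copies at site [k], which is the Kronecker delta in place of [A]. *)
Definition ntk_chain x x' (k : 'I_n) : R :=
  chain (S := fun l => ('I_(d l) * 'I_(d l))%type)
        (X := fun l => ('I_(D l) * 'I_(D l))%type) (fun l s a b =>
    @phi l (x l) s.1 * @phi l (x' l) s.2 *
    (if l == k then ((s.1, a.1, b.1) == (s.2, a.2, b.2))%:R
     else A (entry s.1 a.1 b.1) * A (entry s.2 a.2 b.2))).

Lemma ntk_sum_chain x x' :
  ntk phi A x x' = \sum_k Defs.eta R D k * ntk_chain x x' k.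
Proof.
rewrite /ntk.
transitivity (\sum_k \sum_(j : 'I_(d k) * 'I_(D k) * 'I_(D (ordS k)))
   (fun i : mps_idx d D => Defs.eta R D (tag i) * dmps phi A x i * dmps phi A x' i)
   (Tagged _ j)).
  by rewrite sig_big_dep/=; apply: eq_bigr => -[].
apply: eq_bigr => k _ /=.
under eq_bigr => j _ do rewrite -mulrA !dmps_chain chain_mul.
rewrite -mulr_sumr; congr (_ * _); rewrite /chain exchange_big/=.
apply: eq_bigr => s _; rewrite exchange_big/=; apply: eq_bigr => a _.
rewrite (bigD1 k)//= eqxx.
under eq_bigr => j _.
  rewrite (bigD1 k)//= eqxx (eq_bigr (fun l => @phi l (x l) (s l).1 *
     @phi l (x' l) (s l).2 * (if l == k
      then (((s l).1, (a l).1, (a (ordS l)).1) ==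
            ((s l).2, (a l).2, (a (ordS l)).2))%:R
      else A (entry (s l).1 (a l).1 (a (ordS l)).1) *
           A (entry (s l).2 (a l).2 (a (ordS l)).2)))); last first.
    by move=> l lk; rewrite (negbTE lk); ring.
  over.
rewrite -mulr_suml; congr (_ * _).
set q := (_, _, _); set q' := (_, _, _).
(* Only the entry read by the second copy at site [k] contributes. *)
rewrite (bigD1 q')//= big1 ?addr0 => [|j jq'].
  by rewrite /entry !eq_Tagged/= eqxx mul1r -/q [RHS]mulrC mulrA.
by rewrite /entry !eq_Tagged/= -/q -/q' (eq_sym q') (negbTE jq') mul0r mulr0.
Qed.

End NTKChain.

(** * First and second moments of the glued chains *)

Section ChainMoments.
Variables (R : realType) (n : nat) (d D : 'I_n -> nat).
Variables (phi : forall k : 'I_n, R -> 'I_(d k) -> R).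
Variables (dT : measure_display) (T : measurableType dT) (P : probability T R).
Variables (A : mps_idx d D -> T -> R) (v : 'I_n -> R).
Hypotheses (indep : mutually_independent P A) (v0 : forall l, 0 < v l).
Hypothesis gauss : forall (k : 'I_n) (s : 'I_(d k)) (a : 'I_(D k))
  (b : 'I_(D (ordS k))), centered_gaussian P (A (entry s a b)) (v k).

Local Notation site l := ('I_(d l) * 'I_(D l) * 'I_(D (ordS l)))%type.

Let measurable_A i : measurable_fun setT (A i).
Proof. by case: i => l [[s a] b]; case: (gauss s a b). Qed.

(** Independence is applied to all entries of all tensors at once, with [e] as multiplicities and
    [c] collecting the deterministic factors; the product is then regrouped by site. *)
Lemma expectation_site_prod (c : 'I_n -> R) (e : forall l, site l -> nat) :
  (forall l j, (e l j <= 4)%N) ->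
  has_expectation P
    (fun w => \prod_l (c l * \prod_(j : site l) A (Tagged _ j) w ^+ e l j))
    (\prod_l (c l * \prod_(j : site l) gauss_moment (v l) (e l j))).
Proof.
move=> e4.
pose e' (i : mps_idx d D) := e (tag i) (tagged i).
have H : has_expectation P (fun w => \prod_i A i w ^+ e' i)
    (\prod_i gauss_moment (v (tag i)) (e' i)).
  apply: (expectation_prod measurable_A indep (g := fun i y => y ^+ e' i)).
    by move=> i; exact: measurable_funX.
  move=> [l [[s a] b]] /=; apply: gaussian_moment => //; first exact: gauss.
  exact: e4.
rewrite big_split/=.
apply: has_expectation_eq (has_expectationZ (\prod_l c l) H) => [w|].
  rewrite big_split/=; congr (_ * _).
  rewrite [RHS]sig_big_dep/=.
  by apply: eq_bigr => -[].
congr (_ * _).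
rewrite [RHS]sig_big_dep/=.
by apply: eq_bigr => -[].
Qed.

Lemma expectation_chain (S X : 'I_n -> finType)
    (f : T -> forall l, S l -> X l -> X (ordS l) -> R)
    (g : forall l, S l -> X l -> X (ordS l) -> R) :
  (forall (s : {dffun forall l, S l}) (a : {dffun forall l, X l}),
    has_expectation P (fun w => \prod_l f w l (s l) (a l) (a (ordS l)))
                      (\prod_l g l (s l) (a l) (a (ordS l)))) ->
  has_expectation P (fun w => chain (f w)) (chain g).
Proof.
move=> fg; apply: has_expectation_sum => s _.
by apply: has_expectation_sum => a _; exact: fg.
Qed.

Lemma expectation_ntk_chain x x' k :
  has_expectation P (fun w => ntk_chain phi (A^~ w) x x' k)
  (chain (S := fun l => ('I_(d l) * 'I_(d l))%type)
         (X := fun l => ('I_(D l) * 'I_(D l))%type) (fun l s a b =>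
    @phi l (x l) s.1 * @phi l (x' l) s.2 * (if l == k then 1 else v l) *
    ((s.1, a.1, b.1) == (s.2, a.2, b.2))%:R)).
Proof.
apply: expectation_chain => s a.
pose q1 l : site l := ((s l).1, (a l).1, (a (ordS l)).1).
pose q2 l : site l := ((s l).2, (a l).2, (a (ordS l)).2).
pose c l := @phi l (x l) (s l).1 * @phi l (x' l) (s l).2 *
  (if l == k then (q1 l == q2 l)%:R else 1).
pose e l (j : site l) := if l == k then 0%N else ((q1 l == j) + (q2 l == j))%N.
have e4 l j : (e l j <= 4)%N by rewrite /e; case: (l == k); do 2!case: (_ == j).
apply: has_expectation_eq (expectation_site_prod c e4).
  move=> w; apply: eq_bigr => l _; rewrite /c /e; case: eqP => _.
    by rewrite big1 ?mulr1// => j _; rewrite expr0.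
  under eq_bigr do rewrite exprD.
  rewrite big_split/= mulr1.
  by rewrite !(prod_expr_eq (fun j : site l => A (Tagged _ j) w)).
apply: eq_bigr => l _; rewrite /c /e; case: eqP => _.
  by rewrite big1// !mulr1.
by rewrite moment_pair mulr1 mulrA.
Qed.

(** At site [k] the two deltas of the squared chain are exactly the pairing 12|34 and are
    deterministic, so they go into [c] with exponents 0. At the other sites [moment_wick] yields the
    sum over pairings. *)
Lemma expectation_ntk_chain_sqr x x' k :
  has_expectation P (fun w => ntk_chain phi (A^~ w) x x' k ^+ 2)
  (chain (S := fun l => (('I_(d l) * 'I_(d l)) * ('I_(d l) * 'I_(d l)))%type)
         (X := fun l => (('I_(D l) * 'I_(D l)) * ('I_(D l) * 'I_(D l)))%type)
    (fun l s a b => \sum_(p : option bool)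
      (@phi l (x l) s.1.1 * @phi l (x' l) s.1.2 *
       (@phi l (x l) s.2.1 * @phi l (x' l) s.2.2) *
       (if l == k then (p == None)%:R else v l ^+ 2) * (paired p s)%:R) *
      (paired p a)%:R * (paired p b)%:R)).
Proof.
under eq_fun do rewrite expr2 /ntk_chain chain_mul.
apply: expectation_chain => s a.
pose q l : (site l * site l) * (site l * site l) :=
  ((((s l).1.1, (a l).1.1, (a (ordS l)).1.1), ((s l).1.2, (a l).1.2, (a (ordS l)).1.2)),
   (((s l).2.1, (a l).2.1, (a (ordS l)).2.1), ((s l).2.2, (a l).2.2, (a (ordS l)).2.2))).
have qE p l : paired p (q l) =
    paired p (s l) && paired p (a l) && paired p (a (ordS l)).
  rewrite -paired_pair; set r := (X in _ = paired p X && _).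
  by rewrite (paired_pair p r (a (ordS l))).
pose f l := @phi l (x l) (s l).1.1 * @phi l (x' l) (s l).1.2 *
       (@phi l (x l) (s l).2.1 * @phi l (x' l) (s l).2.2).
pose c l := f l * (if l == k then (paired None (q l))%:R else 1).
pose e l (j : site l) := if l == k then 0%N else
  (((q l).1.1 == j) + ((q l).1.2 == j) + (((q l).2.1 == j) + ((q l).2.2 == j)))%N.
have e4 l j : (e l j <= 4)%N by rewrite /e; case: (l == k); do 4!case: (_ == j).
apply: has_expectation_eq (expectation_site_prod c e4).
  move=> w; apply: eq_bigr => l _; rewrite /c /e; case: eqP => _.
    rewrite big1 ?mulr1 => [|j _]; last by rewrite expr0.
    by rewrite /= -mulnb natrM /f; ring.
  under eq_bigr do rewrite !exprD.
  rewrite !big_split/= mulr1.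
  rewrite !(prod_expr_eq (fun j : site l => A (Tagged _ j) w)).
  by rewrite /f /q/= /entry; ring.
apply: eq_bigr => l _; rewrite /c /e; case: eqP => _.
  rewrite big1// !mulr1 qE sum_option_bool !mulr0 !mul0r !addr0 mulr1.
  by rewrite -!mulnb !natrM !mulrA.
rewrite moment_wick mulr1 mulr_sumr; apply: eq_bigr => p _.
by rewrite qE -!mulnb !natrM /f !mulrA.
Qed.

End ChainMoments.

Lemma cyclic_const (n : nat) (V : Type) (f : 'I_n -> V) :
  (forall l, f l = f (ord_pred l)) -> forall l l', f l = f l'.
Proof.
case: n f => [f _ [] //|n f fE].
suff f0 l : f l = f ord0 by move=> l l'; rewrite !f0.
case: l => m; elim: m => [|m ih] mn; first by congr f; exact: val_inj.
rewrite fE -(ih (ltnW mn)); congr f; apply: val_inj => /=.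
by rewrite modnDr modn_small// ltnW.
Qed.

(** Cauchy-Schwarz against the constant 1, which avoids covariances between different terms of the
    kernel. *)
Lemma sqr_sum_le (R : realFieldType) (n : nat) (y : 'I_n -> R) :
  (\sum_k y k) ^+ 2 <= n%:R * \sum_k y k ^+ 2.
Proof.
rewrite expr2 big_distrlr/=.
apply: (@le_trans _ _ (\sum_k \sum_(j < n) (y k ^+ 2 / 2 + y j ^+ 2 / 2))).
  apply: ler_sum => k _; apply: ler_sum => j _.
  by have := sqr_ge0 (y k - y j); nra.
have E (a : 'I_n -> R) : \sum_k \sum_j (a k + a j) = n%:R * (\sum_k a k) *+ 2.
  transitivity (\sum_k (a k *+ n + \sum_j a j)).
    by apply: eq_bigr => k _; rewrite big_split/= sumr_const card_ord.
  by rewrite big_split/= sumr_const card_ord sumrMnl mulr2n mulr_natl.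
by rewrite E -mulr_suml mulrA -mulr_natr divfK.
Qed.

(** * Dependence of the moments on the bond dimensions *)

Section Evaluation.
Variables (R : realType) (n : nat) (d D : 'I_n -> nat).
Variables (phi : forall k : 'I_n, R -> 'I_(d k) -> R) (sigma : 'I_n -> R).
Hypothesis D0 : forall l, (0 < D l)%N.
Implicit Types (x : 'I_n -> R) (k l : 'I_n).
Local Notation eta := (Defs.eta R D).
Local Notation v l := (sigma l ^+ 2 / Num.sqrt (((D l) * (D (ordS l)))%N%:R)).

(** Around the cycle each bond dimension enters two learning rates, each time with exponent -1/2. *)
Lemma prod_eta : \prod_l (eta l * (D l)%:R) = 1.
Proof.
have E l : eta l = (Num.sqrt (D l)%:R)^-1 * (Num.sqrt (D (ordS l))%:R)^-1.
  by rewrite /Defs.eta natrM sqrtrM ?ler0n// invfM.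
under eq_bigr do rewrite E.
rewrite 2!big_split/=.
have -> : \prod_(l < n) (Num.sqrt (D (ordS l))%:R)^-1 =
    \prod_(l < n) (Num.sqrt (D l)%:R)^-1 :> R.
  by rewrite [RHS](reindex_inj (can_inj (@ordSK n))).
rewrite -!big_split/= big1// => l _.
rewrite -invfM -expr2 sqr_sqrtr ?ler0n// mulVf// pnatr_eq0 -lt0n; exact: D0.
Qed.

(** The variance at site [l] is [sigma l ^+ 2 * eta l]; site [k] has no variance, and its missing
    [eta k] is supplied by the learning rate. *)
Let eta_off k l : R := if l == k then 1 else eta l.

Lemma prod_eta_off k : eta k * \prod_l (eta_off k l * (D l)%:R) = 1.
Proof.
rewrite -[RHS]prod_eta [in RHS](bigD1 k)//= (bigD1 k)//= /eta_off eqxx mul1r mulrA.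
by congr (_ * _); apply: eq_bigr => l /negbTE ->.
Qed.

Definition ntk_limit_term x x' k : R :=
  fdot phi k (x k) (x' k) *
  \prod_(l | l != k) (sigma l ^+ 2 * fdot phi l (x l) (x' l)).

Lemma sum_diag (X : finType) (F : X * X -> R) :
  \sum_q F q * (q.1 == q.2)%:R = \sum_u F (u, u).
Proof.
transitivity (\sum_a \sum_b F (a, b) * (a == b)%:R).
  by rewrite pair_bigA; apply: eq_bigr => -[].
apply: eq_bigr => a _; rewrite (bigD1 a)//= eqxx mulr1 big1 ?addr0// => b.
by rewrite eq_sym => /negbTE ->; rewrite mulr0.
Qed.

(** Two copies admit a single pairing, so [chain_transfer] is used with label type [unit]; the bond
    sums cancel exactly against the normalization. *)
Lemma ntk_chain_mean x x' k :
  eta k * chain (S := fun l => ('I_(d l) * 'I_(d l))%type)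
         (X := fun l => ('I_(D l) * 'I_(D l))%type) (fun l s a b =>
    @phi l (x l) s.1 * @phi l (x' l) s.2 * (if l == k then 1 else v l) *
    ((s.1, a.1, b.1) == (s.2, a.2, b.2))%:R) = ntk_limit_term x x' k.
Proof.
pose g l (p : unit) (s : 'I_(d l) * 'I_(d l)) : R := @phi l (x l) s.1 * @phi l (x' l) s.2 *
  (if l == k then 1 else v l) * (s.1 == s.2)%:R.
pose h l (p : unit) (a : 'I_(D l) * 'I_(D l)) : R := (a.1 == a.2)%:R.
rewrite (@eq_chain _ _ _ _ _ (fun l s a b => \sum_(p : unit) g l p s * h l p a * h (ordS l) p b));
  last first.
  move=> l s a b; rewrite (bigD1 tt)//= big1 ?addr0 => [|[]//].
  by rewrite /g /h !xpair_eqE -!mulnb !natrM !mulrA.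
rewrite chain_transfer (bigD1 [ffun=> tt])//= [X in _ + X]big1 => [|p /eqP[]]; last first.
  by apply/ffunP => l; case: (p l) ([ffun=> tt] l) => [] [].
rewrite addr0.
under eq_bigr => l _.
  rewrite (_ : _ * _ = eta_off k l * (D l)%:R *
    ((if l == k then 1 else sigma l ^+ 2) * fdot phi l (x l) (x' l))); last first.
    rewrite !ffunE /g /h.
    under [X in _ * X = _]eq_bigr do rewrite -natrM mulnb andbb -[_%:R]mul1r.
    rewrite !sum_diag sumr_const card_ord /eta_off /fdot mulr_sumr/=.
    rewrite -mulr_natl mulr1 mulr_suml mulr_sumr; apply: eq_bigr => s _ /=.
    by case: eqP => _; rewrite /Defs.eta; ring.
  over.
rewrite big_split/= mulrA prod_eta_off mul1r (bigD1 k)//= eqxx mul1r.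
by congr (_ * _); apply: eq_bigr => l /negbTE ->.
Qed.

(** The part of the site factor that is free of bond dimensions. *)
Definition pairing_weight x x' k l (p : option bool) : R :=
  (if l == k then (p == None)%:R else sigma l ^+ 4) *
  \sum_(s : ('I_(d l) * 'I_(d l)) * ('I_(d l) * 'I_(d l)))
    @phi l (x l) s.1.1 * @phi l (x' l) s.1.2 *
    (@phi l (x l) s.2.1 * @phi l (x' l) s.2.2) * (paired p s)%:R.

Lemma pairing_weight_None x x' k :
  \prod_l pairing_weight x x' k l None = ntk_limit_term x x' k ^+ 2.
Proof.
have E l : pairing_weight x x' k l None =
    (if l == k then 1 else sigma l ^+ 4) * fdot phi l (x l) (x' l) ^+ 2.
  rewrite /pairing_weight eqxx; congr (_ * _).
  transitivity ((\sum_(s : 'I_(d l) * 'I_(d l))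
      @phi l (x l) s.1 * @phi l (x' l) s.2 * (s.1 == s.2)%:R) ^+ 2).
    rewrite expr2 big_distrlr pair_bigA/=; apply: eq_bigr => s _.
    by rewrite -mulnb natrM; ring.
  by rewrite (sum_diag (fun s => @phi l (x l) s.1 * @phi l (x' l) s.2)).
rewrite (eq_bigr _ (fun l _ => E l)) (bigD1 k)//= eqxx mul1r.
rewrite /ntk_limit_term exprMn -prodrXl; congr (_ * _).
by apply: eq_bigr => l /negbTE ->; rewrite exprMn -exprM.
Qed.

Lemma ntk_chain_second_moment x x' k :
  eta k ^+ 2 *
  chain (S := fun l => (('I_(d l) * 'I_(d l)) * ('I_(d l) * 'I_(d l)))%type)
        (X := fun l => (('I_(D l) * 'I_(D l)) * ('I_(D l) * 'I_(D l)))%type)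
    (fun l s a b => \sum_(p : option bool)
      (@phi l (x l) s.1.1 * @phi l (x' l) s.1.2 *
       (@phi l (x l) s.2.1 * @phi l (x' l) s.2.2) *
       (if l == k then (p == None)%:R else v l ^+ 2) * (paired p s)%:R) *
      (paired p a)%:R * (paired p b)%:R) =
  \sum_(p : {ffun 'I_n -> option bool}) \prod_l (pairing_weight x x' k l (p l) *
     (if p l == p (ord_pred l) then 1 else (D l)%:R^-1)).
Proof.
pose g l (p : option bool) (s : ('I_(d l) * 'I_(d l)) * ('I_(d l) * 'I_(d l))) : R :=
  @phi l (x l) s.1.1 * @phi l (x' l) s.1.2 *
  (@phi l (x l) s.2.1 * @phi l (x' l) s.2.2) *
  (if l == k then (p == None)%:R else v l ^+ 2) * (paired p s)%:R.
pose h l (p : option bool) (a : ('I_(D l) * 'I_(D l)) * ('I_(D l) * 'I_(D l))) : R :=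
  (paired p a)%:R.
rewrite (@eq_chain _ _ _ _ _ (fun l s a b =>
  \sum_(p : option bool) g l p s * h l p a * h (ordS l) p b))//.
rewrite chain_transfer mulr_sumr; apply: eq_bigr => p _.
have one : eta k ^+ 2 * (\prod_l (eta_off k l * (D l)%:R)) ^+ 2 = 1.
  by rewrite -exprMn prod_eta_off expr1n.
rewrite -[RHS]mul1r -[X in _ = X * _]one -mulrA.
congr (_ * _); rewrite -prodrXl -big_split/=; apply: eq_bigr => l _.
rewrite /h sum_paired2 card_ord.
have -> : \sum_s g l (p l) s = eta_off k l ^+ 2 * pairing_weight x x' k l (p l).
  rewrite /pairing_weight !mulr_sumr; apply: eq_bigr => s _.
  by rewrite /g /eta_off /Defs.eta; case: eqP => _; ring.
have Dl : (D l)%:R != 0 :> R by rewrite pnatr_eq0 -lt0n; exact: D0.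
by case: eqP => _; rewrite ?natrX; field.
Qed.

(** If [p] is constant around the cycle, its value is not [None] and the weight at site [k]
    vanishes. Otherwise [p] changes at some [l0], and the factor [1 / D l0] is one term of the
    sum. *)
Lemma pairing_term_le x x' k (p : {ffun 'I_n -> option bool}) :
  p != [ffun=> None] ->
  \prod_l (pairing_weight x x' k l (p l) *
     (if p l == p (ord_pred l) then 1 else (D l)%:R^-1)) <=
  (\prod_l `|pairing_weight x x' k l (p l)|) * \sum_l (D l)%:R^-1.
Proof.
move=> pN.
have r0 l : 0 <= (if p l == p (ord_pred l) then 1 else (D l)%:R^-1) :> R.
  by case: ifP.
have [/forallP pc|/forallPn[l0 pl0]] := boolP [forall l, p l == p (ord_pred l)].
  have pk : p k != None.
    apply: contra pN => /eqP pk; apply/eqP/ffunP => l; rewrite ffunE -pk.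
    by apply: cyclic_const => l'; exact/eqP/pc.
  rewrite (bigD1 k)//= {1}/pairing_weight eqxx (negbTE pk) !mul0r.
  by rewrite mulr_ge0 ?prodr_ge0// sumr_ge0.
apply: (le_trans (ler_norm _)); rewrite normr_prod.
under eq_bigr => l _ do rewrite normrM (ger0_norm (r0 l)).
rewrite big_split/= ler_wpM2l ?prodr_ge0//.
rewrite (bigD1 l0)//= (negbTE pl0) [leRHS](bigD1 l0)//=.
apply: (@le_trans _ _ (D l0)%:R^-1); last by rewrite lerDl sumr_ge0.
rewrite ler_piMr// prodr_ile1// => l _; rewrite r0/=; case: ifP => // _.
by rewrite invf_le1 ?ler1n ?ltr0n; exact: D0.
Qed.

End Evaluation.

(** * Chebyshev bound for the kernel *)

Section Concentration.
Variables (R : realType) (n : nat) (d : 'I_n -> nat).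
Variables (phi : forall k : 'I_n, R -> 'I_(d k) -> R) (sigma : 'I_n -> R).
Hypothesis sigma0 : forall k, 0 < sigma k.
Variables (dT : measure_display) (T : measurableType dT) (P : probability T R).

Lemma measurable_chain (S X : 'I_n -> finType)
    (f : T -> forall l, S l -> X l -> X (ordS l) -> R) :
  (forall l s a b, measurable_fun setT (fun w => f w l s a b)) ->
  measurable_fun setT (fun w => chain (f w)).
Proof.
move=> mf; apply: measurable_sum => s; apply: measurable_sum => a.
by apply: measurable_prod => l _; exact: mf.
Qed.

Lemma measurable_ntk (D : 'I_n -> nat) (A : mps_idx d D -> T -> R) x x' :
  (forall i, measurable_fun setT (A i)) ->
  measurable_fun setT (fun w => ntk phi (A^~ w) x x').
Proof.
move=> mA; under eq_fun do rewrite ntk_sum_chain.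
apply: measurable_sum => k; apply: measurable_funM => //.
apply: measurable_chain => l s a b; apply: measurable_funM => //.
by case: eqP => _ //; apply: measurable_funM.
Qed.

(** The leading [n] comes from [sqr_sum_le]; nothing here depends on the bond dimensions. *)
Definition concentration_constant x x' : R :=
  n%:R * \sum_k \sum_(p : {ffun 'I_n -> option bool})
    \prod_l `|pairing_weight phi sigma x x' k l (p l)|.

Lemma concentration_constant_ge0 x x' : 0 <= concentration_constant x x'.
Proof.
rewrite mulr_ge0// sumr_ge0// => k _; rewrite sumr_ge0// => p _.
exact: prodr_ge0.
Qed.

Lemma ntk_concentration (D : 'I_n -> nat) (A : mps_idx d D -> T -> R) x x' (eps : R) :
  (forall l, (0 < D l)%N) -> mutually_independent P A ->
  (forall (k : 'I_n) (s : 'I_(d k)) (a : 'I_(D k)) (b : 'I_(D (ordS k))),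
     centered_gaussian P (A (entry s a b))
       (sigma k ^+ 2 / Num.sqrt (((D k) * (D (ordS k)))%N%:R))) ->
  0 < eps ->
  fine (P [set w | eps < `|ntk phi (A^~ w) x x' - ntk_limit phi sigma x x'|]) <=
  eps ^- 2 * concentration_constant x x' * \sum_l (D l)%:R^-1.
Proof.
move=> D0 indep gauss eps0.
set L := ntk_limit _ _ _ _; set E := [set w | _].
have mA i : measurable_fun setT (A i).
  by case: i => l [[s a] b]; case: (gauss l s a b).
have mE : measurable E.
  rewrite -[E]setTI; apply: measurable_fun_ltr => //.
  apply: measurableT_comp => //; apply: measurable_funB => //.
  exact: measurable_ntk.
pose v l := sigma l ^+ 2 / Num.sqrt (((D l) * (D (ordS l)))%N%:R).
have v0 l : 0 < v l.
  by rewrite divr_gt0 ?exprn_gt0// sqrtr_gt0 ltr0n muln_gt0 !D0.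
pose Lk k := ntk_limit_term phi sigma x x' k.
pose Y k w := Defs.eta R D k * ntk_chain phi (A^~ w) x x' k.
pose V k := \sum_(p : {ffun 'I_n -> option bool} | p != [ffun=> None])
  \prod_l (pairing_weight phi sigma x x' k l (p l) *
     (if p l == p (ord_pred l) then 1 else (D l)%:R^-1)).
have var k : has_expectation P (fun w => (Y k w - Lk k) ^+ 2) (V k).
  have E1 := has_expectationZ (Defs.eta R D k)
    (expectation_ntk_chain phi indep v0 gauss x x' k).
  rewrite (ntk_chain_mean phi sigma D0) -/(Lk k) -/(Y k) in E1.
  have E2 := has_expectationZ (Defs.eta R D k ^+ 2)
    (expectation_ntk_chain_sqr phi indep v0 gauss x x' k).
  rewrite (ntk_chain_second_moment phi sigma D0) (bigD1 [ffun=> None])//= -/(V k) in E2.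
  (* The mean of [Y k] is exactly [Lk k]; the [None] term of the second moment is its square and
     cancels, leaving [V k]. *)
  apply: has_expectation_eq (has_expectationD E2 (has_expectationD
    (has_expectationZ (- (2 * Lk k)) E1) (has_expectation_cst P (Lk k ^+ 2)))).
    by move=> w; rewrite /Y; ring.
  rewrite (eq_bigr (fun l => pairing_weight phi sigma x x' k l None)).
    by rewrite pairing_weight_None -/(Lk k); ring.
  by move=> l _; rewrite !ffunE eqxx mulr1.
have KE w : ntk phi (A^~ w) x x' - L = \sum_k (Y k w - Lk k).
  by rewrite ntk_sum_chain sumrB.
have := has_expectation_le (has_expectationZ (eps ^+ 2) (has_expectation_indic P mE))
  (has_expectationZ n%:R (has_expectation_sum (index_enum 'I_n) (fun k _ => var k))).
(* Pointwise form of Chebyshev's inequality. *)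
have key : forall w, eps ^+ 2 * \1_E w <= n%:R * \sum_k (Y k w - Lk k) ^+ 2.
  move=> w; rewrite indicE; have [wE|wE] := boolP (w \in E); last first.
    by rewrite mulr0 mulr_ge0// sumr_ge0// => k _; exact: sqr_ge0.
  apply: le_trans (sqr_sum_le _); rewrite -KE mulr1 -[leRHS]real_normK ?num_real//.
  rewrite ler_pXn2r ?nnegrE//; last exact: ltW.
  by move: wE; rewrite inE => /ltW.
move=> /(_ xpredT key) H.
rewrite -mulrA ler_pdivlMl ?exprn_gt0//; apply: (le_trans H).
rewrite /concentration_constant -mulrA ler_wpM2l// mulr_suml ler_sum// => k _.
rewrite mulr_suml.
apply: (@le_trans _ _ (\sum_(p : {ffun 'I_n -> option bool} | p != [ffun=> None])
  (\prod_l `|pairing_weight phi sigma x x' k l (p l)|) * \sum_l (D l)%:R^-1)).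
  by apply: ler_sum => p pN; exact: pairing_term_le.
rewrite [leRHS](bigD1 [ffun=> None])//= lerDr mulr_ge0 ?prodr_ge0//.
by rewrite sumr_ge0.
Qed.

End Concentration.

(** * Iterated upper limits *)

Section SequentialLimsup.
Variable R : realType.

Section UnitInterval.
Variable u : nat -> R.
Hypothesis u01 : forall N, 0 <= u N <= 1.

Let bounded_u : bounded_fun (u : nat -> R^o).
Proof.
exists 1; split => // M M1 N _ /=; have /andP[u0 u1] := u01 N.
by rewrite ger0_norm// (le_trans u1)// ltW.
Qed.

Let has_ubound_u N : has_ubound (sdrop u N).
Proof. by exists 1 => _ [m _ <-]; have /andP[] := u01 m. Qed.

Let sups_ge0 N : 0 <= sups u N.
Proof.
have /andP[u0 _] := u01 N; apply: (le_trans u0).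
by apply: ub_le_sup => //; exists N => //=.
Qed.

Lemma limn_sup_ge0 : 0 <= limn_sup u.
Proof.
rewrite limn_supE//; apply: lb_le_inf; first by exists (sups u 0); exists 0%N.
by move=> _ [N _ <-].
Qed.

Lemma limn_sup_le c :
  (forall e, 0 < e -> exists N0, forall N, (N0 <= N)%N -> u N <= c + e) ->
  limn_sup u <= c.
Proof.
move=> uc; rewrite limn_supE//; apply/ler_addgt0Pr => e e0.
have [N0 N0P] := uc e e0.
apply: (@le_trans _ _ (sups u N0)).
  by apply: ge_inf; [exists 0 => _ [N _ <-]|exists N0].
apply: ge_sup; first by exists (u N0); exists N0 => /=.
by move=> _ [m /= mN <-]; exact: N0P.
Qed.

End UnitInterval.

(** The upper limit in the first dimension removes its term from the bound and stays in the unit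
    interval, so the hypotheses hold again for the remaining list. *)
Lemma seq_limsup_eq0 n (s : seq 'I_n) (f : ('I_n -> nat) -> R) C :
  uniq s -> 0 <= C -> (forall D, 0 <= f D <= 1) ->
  (forall D, (forall l, l \in s -> (0 < D l)%N) ->
     f D <= C * \sum_(l <- s) (D l)%:R^-1) ->
  forall D0, seq_limsup s f D0 = 0.
Proof.
move=> us C0; elim: s us f => [_ f f01 fC D0 /=|l s ih /= /andP[ls us] f f01 fC D0].
  apply/eqP; rewrite eq_le; have /andP[-> _] := f01 D0.
  by have := fC D0; rewrite big_nil mulr0 andbT; apply.
apply: ih => // D.
  by rewrite limn_sup_ge0// limn_sup_le// => e e0; exists 0%N => N _;
    have /andP[_ /le_trans] := f01 (setdim D l N); apply; rewrite lerDl ltW.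
move=> D0s; apply: limn_sup_le => // e e0.
have [N0 N0P] : exists N0, forall N, (N0 <= N)%N -> C * N.+1%:R^-1 <= e.
  exists (Num.bound (C / e)) => N N0N.
  rewrite ler_pdivrMr ?ltr0n// mulrC -ler_pdivrMr//.
  apply: le_trans (ltW (archi_boundP _)) _; first by rewrite divr_ge0// ltW.
  by rewrite ler_nat (leq_trans N0N).
exists N0.+1 => -[//|N] N0N.
apply: (le_trans (fC _ _)) => [j|].
  rewrite inE /setdim; case: eqP => //= _; exact: D0s.
rewrite big_cons {1}/setdim eqxx mulrDr addrC lerD ?N0P//.
rewrite [leLHS](_ : _ = C * \sum_(j <- s) (D j)%:R^-1)//; congr (_ * _).
(* Since [l] does not recur in [s], resetting its dimension leaves the other terms alone. *)
rewrite big_seq [RHS]big_seq; apply: eq_bigr => j js; rewrite /setdim.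
by case: eqP => // jl; rewrite -jl js in ls.
Qed.

End SequentialLimsup.

Unset Implicit Arguments.

(** Deviation probabilities are nonnegative, so an iterated upper limit equal to 0 forces the
    iterated lower limit to be 0 as well. The permutation [order] allows every order of the
    successive limits. *)
Theorem theorem2 (R : realType) (n : nat) (hn : (0 < n)%N) (d : 'I_n -> nat)
  (phi : forall k : 'I_n, R -> 'I_(d k) -> R) (sigma : 'I_n -> R)
  (hsigma : forall k, 0 < sigma k)
  (dT : measure_display) (T : measurableType dT) (P : probability T R)
  (A : forall D : 'I_n -> nat, mps_idx d D -> T -> R)
  (hindep : forall D, mutually_independent P (A D))
  (hgauss : forall D (k : 'I_n) (s : 'I_(d k)) (a : 'I_(D k)) (b : 'I_(D (ordS k))),
     centered_gaussian P (A D (entry s a b))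
       (sigma k ^+ 2 / Num.sqrt (((D k) * (D (ordS k)))%N%:R)))
  (xi xj : 'I_n -> R)
  (order : {perm 'I_n}) :
  forall eps : R, 0 < eps ->
  forall D0 : 'I_n -> nat,
    seq_limsup [seq order l | l <- enum 'I_n]
      (fun D => fine (P [set w | eps < `| ntk phi (fun i => A D i w) xi xj
                                           - ntk_limit phi sigma xi xj | ]))
      D0 = 0.
Proof.
move=> eps eps0.
apply: (@seq_limsup_eq0 R n _ _ (eps ^- 2 * concentration_constant phi sigma xi xj)).
- by rewrite map_inj_uniq ?enum_uniq//; exact: perm_inj.
- by rewrite mulr_ge0 ?concentration_constant_ge0// invr_ge0 exprn_ge0// ltW.
- move=> D.
  have mE : measurable [set w | eps < `|ntk phi (fun i => A D i w) xi xj
                                        - ntk_limit phi sigma xi xj|].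
    rewrite -[X in measurable X]setTI; apply: measurable_fun_ltr => //.
    apply: measurableT_comp => //; apply: measurable_funB => //.
    apply: measurable_ntk => -[l [[s a] b]].
    by case: (hgauss D l s a b).
  rewrite fine_ge0 ?measure_ge0//= -lee_fin fineK ?fin_num_measure//.
  exact: probability_le1.
move=> D Dpos.
(* A permutation is onto, so positivity along the list is positivity of every bond dimension. *)
have Dpos' l : (0 < D l)%N.
  apply: Dpos; apply/mapP; exists ((order^-1)%g l); first by rewrite mem_enum.
  by rewrite permKV.
have -> : \sum_(l <- [seq order l | l <- enum 'I_n]) (D l)%:R^-1 =
    \sum_l (D l)%:R^-1 :> R.
  by rewrite big_map big_enum/= [RHS](reindex_perm order).
exact: ntk_concentration.
Qed.
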